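(* Let $v\in\{0,1\}^d$ and let $P\subseteq[0,1]^d$ be a convex set that is a convex corner with respect to $v$. Then $N(P)$ and $N_+(P)$ are convex corners with respect to $v$.
   Context: A nonempty convex set $P\subseteq\mathbb{R}^d_+$ is lower comprehensive if for every $x\in P$, every $y\in\mathbb{R}^d_+$ with $y\le x$ is in $P$. A convex set $P\subseteq[0,1]^d$ is a convex corner with respect to $v\in\{0,1\}^d$ if there is a transformation $A$ mapping $\{0,1\}^d$ onto itself (an affine bijection of $\mathbb{R}^d$ whose homogenization is a linear map of $\mathbb{R}^{d+1}$ mapping $Q$ onto $Q$, e.g. coordinate permutations and flips $x_i\mapsto1-x_i$) such that $Av=0$ and $AP$ is lower comprehensive. Vectors in $\mathbb{R}^{d+1}$ have coordinates indexed $0,\dots,d$ and are written $(x_0,x)$. $Q\subseteq\mathbb{R}^{d+1}$ is the convex cone generated by all $(1,x)$ with $x\in\{0,1\}^d$; for a convex cone $C$, $C^*=\{s:s^Tx\ge0\ \forall x\in C\}$. For a convex cone $K\subseteq Q$: $M(K)$ is the set of real symmetric $(d+1)\times(d+1)$ matrices $Y$ with $Ye_0=\mathrm{diag}(Y)$ and $u^TYv\ge0$ for all $u\in Q^*,v\in K^*$; $M_+(K)$ its positive semidefinite members; $N(K)=\{\mathrm{diag}(Y):Y\in M(K)\}$, $N_+(K)=\{\mathrm{diag}(Y):Y\in M_+(K)\}$. For a convex $P\subseteq[0,1]^d$, $K_P=\{(\lambda,\lambda x):x\in P,\lambda\ge0\}$, $N(P)=\{x:(1,x)\in N(K_P)\}$,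 $N_+(P)=\{x:(1,x)\in N_+(K_P)\}$. *)

(* Defs.v *)
From HB Require Import structures.
From mathcomp Require Import all_boot all_order all_algebra.
From mathcomp Require Import boolp classical_sets reals convex.

Set Implicit Arguments.
Unset Strict Implicit.
Unset Printing Implicit Defensive.

Import Order.TTheory GRing.Theory Num.Theory.

Local Open Scope classical_set_scope.
Local Open Scope ring_scope.

(* Vectors of R^d are column vectors 'cV[R]_d.  R^(d+1) is 'cV[R]_(1 + d), so  *)
(* that (x_0, x) is col_mx x_0%:M x and index 0 is the homogenizing one.       *)

Section Cubes.
Variables (R : realType) (d : nat).
Implicit Types (x y v b : 'cV[R]_d) (P : set 'cV[R]_d) (M : 'M[R]_d).

Definition vertices01 : set 'cV[R]_d :=
  [set x | forall i, x i 0 = 0 \/ x i 0 = 1].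

Definition cube01 : set 'cV[R]_d := [set x | forall i, 0 <= x i 0 <= 1].

Definition nonneg_orthant : set 'cV[R]_d := [set x | forall i, 0 <= x i 0].

Definition le_vec x y : Prop := forall i, x i 0 <= y i 0.

Definition lower_comprehensive P : Prop :=
  [/\ P !=set0, convex_set P, P `<=` nonneg_orthant &
      forall x y, P x -> nonneg_orthant y -> le_vec y x -> P y].

Definition homog x : 'cV[R]_(1 + d) := col_mx 1%:M x.

Definition affine M b x : 'cV[R]_d := M *m x + b.

(* The linear map (x_0, x) |-> (x_0, M x + x_0 b).                             *)
Definition homogenization M b : 'M[R]_(1 + d) := block_mx 1%:M 0 b M.

End Cubes.

Section Cones.
Variables (R : realType) (n : nat).

Definition cone_generated (S : set 'cV[R]_n) : set 'cV[R]_n :=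
  [set x | exists (k : nat) (c : 'I_k -> R) (s : 'I_k -> 'cV[R]_n),
     [/\ forall i, 0 <= c i, forall i, S (s i) & x = \sum_i c i *: s i]].

Definition dual_cone (C : set 'cV[R]_n) : set 'cV[R]_n :=
  [set s | forall x, C x -> 0 <= (s^T *m x) 0 0].

Definition diagonal (Y : 'M[R]_n) : 'cV[R]_n := \col_i Y i i.

Definition psd (Y : 'M[R]_n) : Prop :=
  Y \is symmetricmx /\ forall x : 'cV[R]_n, 0 <= (x^T *m Y *m x) 0 0.

End Cones.

Section LovaszSchrijver.
Variables (R : realType) (d : nat).
Implicit Types (K : set 'cV[R]_(1 + d)) (P : set 'cV[R]_d).

Definition Qcone : set 'cV[R]_(1 + d) :=
  cone_generated [set homog x | x in @vertices01 R d].

Definition M_LS K : set 'M[R]_(1 + d) :=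
  [set Y | [/\ Y \is symmetricmx,
               Y *m delta_mx 0 0 = diagonal Y &
               forall u w, dual_cone Qcone u -> dual_cone K w ->
                 0 <= (u^T *m Y *m w) 0 0]].

Definition Mplus_LS K : set 'M[R]_(1 + d) := M_LS K `&` [set Y | psd Y].

Definition N_cone K : set 'cV[R]_(1 + d) := [set diagonal Y | Y in M_LS K].

Definition Nplus_cone K : set 'cV[R]_(1 + d) :=
  [set diagonal Y | Y in Mplus_LS K].

Definition K_of P : set 'cV[R]_(1 + d) :=
  [set z | exists l x, [/\ P x, 0 <= l & z = col_mx l%:M (l *: x)]].

Definition N_LS P : set 'cV[R]_d := [set x | N_cone (K_of P) (homog x)].

Definition Nplus_LS P : set 'cV[R]_d :=
  [set x | Nplus_cone (K_of P) (homog x)].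

(* x |-> M x + b is an affine bijection mapping {0,1}^d onto itself, and its   *)
(* homogenization maps Q onto Q.                                               *)
Definition cube_transformation (M : 'M[R]_d) (b : 'cV[R]_d) : Prop :=
  [/\ M \in unitmx,
      affine M b @` @vertices01 R d = @vertices01 R d &
      mulmx (homogenization M b) @` Qcone = Qcone].

Definition convex_corner (v : 'cV[R]_d) P : Prop :=
  [/\ convex_set P, P `<=` @cube01 R d &
      exists M b, [/\ cube_transformation M b, affine M b v = 0 &
                      lower_comprehensive (affine M b @` P)]].

End LovaszSchrijver.

(* Main.v *)
(** If an affine map [A x = M x + b] sends 0/1-vectors to 0/1-vectors and [P]
    into [P'], then the congruence [Y |-> T Y T^T] by its homogenization [T]
    sends [M(K_P)] into [M(K_P')] (and preserves positive semidefiniteness), so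
    [A] sends [N(P)] into [N(P')].  Applied to a cube transformation and its
    inverse, this gives [A N(P) = N(A P)] and reduces the theorem to lower
    comprehensive [P].  Applied to the coordinate projections [x_i |-> 0], it
    shows that [N(P)] is closed under zeroing a coordinate; together with
    convexity this allows every coordinate to be lowered at will. *)

From mathcomp Require Import all_boot all_order all_algebra.
From mathcomp Require Import boolp classical_sets reals convex.
From mathcomp Require Import interval_inference ring lra.
Require Import Defs.

Set Implicit Arguments.
Unset Strict Implicit.
Unset Printing Implicit Defensive.

Import Order.TTheory GRing.Theory Num.Theory.

Local Open Scope classical_set_scope.
Local Open Scope ring_scope.

(** * Elementary forms of symmetry and convexity *)

Lemma symmetricmxP (F : fieldType) (n : nat) (Y : 'M[F]_n) :
  reflect (Y^T = Y) (Y \is symmetricmx).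
Proof.
by apply: (iffP (is_hermitianmxP _ _ _)); rewrite expr0 scale1r map_mx_id.
Qed.

Lemma convex_setP (R : realType) (V : lmodType R) (A : set V) :
  convex_set A <->
  forall t x y, 0 <= t <= 1 -> A x -> A y -> A (t *: x + (1 - t) *: y).
Proof.
split => [cA t x y /andP[t0 t1] Ax Ay|cA x y t /set_mem Ax /set_mem Ay].
  by have /set_mem := cA x y (Itv01 t0 t1) (mem_set Ax) (mem_set Ay).
by apply: mem_set; apply: cA => //; apply/andP; split.
Qed.

(** * Homogenization of points and affine maps *)

Section Homogenization.
Variables (R : realType) (d : nat).
Implicit Types (x y b : 'cV[R]_d) (M : 'M[R]_d).

Lemma homog0 : homog 0 = delta_mx 0 0 :> 'cV[R]_(1 + d).
Proof.
apply/colP => i; rewrite -[i]splitK; case: (split i) => j /=.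
  by rewrite /homog col_mxEu !mxE ord1 -!val_eqE.
by rewrite /homog col_mxEd !mxE -!val_eqE.
Qed.

Lemma homogenization_homog M b x :
  homogenization M b *m homog x = homog (affine M b x).
Proof.
by rewrite mul_block_col !mul1mx mul0mx addr0 mulmx1 addrC.
Qed.

(** The top row of the homogenization is [e_0^T]. This is what lets a congruence keep the condition
    [Y e_0 = diag Y]. *)
Lemma trmx_homogenization_homog0 M b :
  (homogenization M b)^T *m homog 0 = homog 0.
Proof.
by rewrite tr_block_mx mul_block_col !mulmx0 !addr0 trmx0 mul0mx trmx1 mulmx1.
Qed.

Lemma homog_conv t x y :
  homog (t *: x + (1 - t) *: y) = t *: homog x + (1 - t) *: homog y.
Proof.
rewrite /homog !scale_col_mx add_col_mx; congr col_mx.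
by rewrite -scalerDl addrC subrK scale1r.
Qed.

Lemma K_ofP (P : set 'cV[R]_d) z :
  K_of P z <-> exists l x, [/\ P x, 0 <= l & z = l *: homog x].
Proof.
by split=> -[l [x [Px l0 ->]]]; exists l, x; split=> //;
  rewrite /homog scale_col_mx scalemx1.
Qed.

End Homogenization.

(** * Cones and their duals under linear maps *)

Section Duality.
Variable R : realType.

Lemma dual_cone_generated n (S : set 'cV[R]_n) u :
  (forall s, S s -> 0 <= (u^T *m s) 0 0) -> dual_cone (cone_generated S) u.
Proof.
move=> uS _ [k [c [s [c0 Ss ->]]]].
rewrite mulmx_sumr summxE sumr_ge0 // => i _.
by rewrite -scalemxAr mxE mulr_ge0 // uS.
Qed.

Lemma dual_cone_trmx m n (T : 'M[R]_(m, n)) C C' w :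
  (forall x, C x -> C' (T *m x)) -> dual_cone C' w -> dual_cone C (T^T *m w).
Proof. by move=> TC Cw x Cx; rewrite trmx_mul trmxK -mulmxA; apply/Cw/TC. Qed.

Lemma Qcone_homogenization d (M : 'M[R]_d) b :
  (forall x, vertices01 x -> vertices01 (affine M b x)) ->
  forall q, Qcone q -> Qcone (homogenization M b *m q).
Proof.
move=> AV q [k [c [s [c0 Ss ->]]]].
exists k, c, (fun i => homogenization M b *m s i); split=> //.
  by move=> i; have [x Vx <-] := Ss i; rewrite homogenization_homog;
    exists (affine M b x); first exact: AV.
by rewrite mulmx_sumr; apply: eq_bigr => i _; rewrite -scalemxAr.
Qed.

Lemma K_of_homogenization d (M : 'M[R]_d) b P P' :
  (forall x, P x -> P' (affine M b x)) ->
  forall z, K_of P z -> K_of P' (homogenization M b *m z).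
Proof.
move=> AP z /K_ofP[l [x [Px l0 ->]]]; apply/K_ofP.
by exists l, (affine M b x); split; rewrite -?scalemxAr ?homogenization_homog //;
  apply: AP.
Qed.

End Duality.

(** * Congruence by a homogenization acting on [M(K)] *)

Section Congruence.
Variables (R : realType) (d : nat).

(* Idempotence of a linear form [h] on the vertices forces its coefficients to
   satisfy [h_0^2 = h_0], [2 h_0 h_j + h_j^2 = h_j] and [h_j h_k = 0] for
   [j <> k], so [h] and [h^2] agree modulo [Y_jj = Y_j0]. *)
Lemma quad_form_diagonal (Y : 'M[R]_(1 + d)) (h : 'rV[R]_(1 + d)) :
  Y^T = Y -> Y *m homog 0 = diagonal Y ->
  (forall x, vertices01 x -> (h *m homog x) 0 0 = 0 \/ (h *m homog x) 0 0 = 1) ->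
  (h *m Y *m h^T) 0 0 = (h *m diagonal Y) 0 0.
Proof.
move=> YT Y0 h01.
pose a := h 0 (lshift d 0); pose m i := h 0 (rshift 1 i).
have hE x : (h *m homog x) 0 0 = a + \sum_i m i * x i 0.
  rewrite mxE big_split_ord big_ord1 /= /homog col_mxEu mxE eqxx mulr1.
  by congr (_ + _); apply: eq_bigr => i _; rewrite col_mxEd.
have idem x : vertices01 x ->
    (a + \sum_i m i * x i 0) ^+ 2 = a + \sum_i m i * x i 0.
  by move=> Vx; rewrite -(hE x); case: (h01 _ Vx) => ->; rewrite ?expr0n ?expr1n.
have E1 i : \sum_k m k * (delta_mx i 0 : 'cV[R]_d) k 0 = m i.
  rewrite (bigD1 i) //= mxE !eqxx mulr1 big1 ?addr0 // => k /negPf ki.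
  by rewrite mxE ki mulr0.
(* The vertices [0], [e_i] and [e_i + e_j] yield the three relations in turn. *)
have a2 : a ^+ 2 = a.
  have := idem 0; rewrite big1 ?addr0; last by move=> i _; rewrite mxE mulr0.
  by apply=> i; left; rewrite mxE.
have m2 i : (a + m i) ^+ 2 = a + m i.
  have := idem (delta_mx i 0); rewrite E1; apply=> k; rewrite mxE.
  by case: (_ && _); [right|left].
have mm i j : i != j -> m i * m j = 0.
  move=> ij; have := idem (delta_mx i 0 + delta_mx j 0).
  under eq_bigr do rewrite mxE mulrDr.
  rewrite big_split /= !E1 => e.
  suff /e e2 : vertices01 (delta_mx i 0 + delta_mx j 0 : 'cV[R]_d).
    (* Subtracting the relations at [e_i] and [e_j] from the one at [e_i + e_j] and adding [a^2 = a]
       leaves [2 m_i m_j = 0]. *)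
    by move: (m2 i) (m2 j) => mi mj; nra.
  move=> k; rewrite !mxE; have [->|ki] := eqVneq k i.
    by rewrite (negPf ij) addr0; right.
  by rewrite add0r; case: (_ && _); [right|left].
have Yd k : Y k (lshift d 0) = Y k k.
  by have /colP/(_ k) := Y0; rewrite homog0 -colE !mxE => <-; congr (Y _ _);
    apply: val_inj.
have Yd' k : Y (lshift d 0) k = Y k k by rewrite -Yd -[in LHS]YT mxE.
rewrite !mxE !big_split_ord !big_ord1 /= !mxE !big_split_ord !big_ord1 /=.
rewrite -/a mulrDl; under eq_bigr do rewrite Yd.
rewrite -addrA; congr (_ + _); first by rewrite mulrAC -expr2 a2.
rewrite mulr_suml -big_split /=; apply: eq_bigr => k _.
rewrite !mxE big_split_ord big_ord1 /= Yd' -/a -/(m k).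
rewrite mulrDl mulr_suml (bigD1 k) //= big1 => [|j jk]; last first.
  by rewrite -/(m j) mulrAC mm // mul0r.
have mk : a * m k *+ 2 + m k ^+ 2 = m k.
  by move: (m2 k); rewrite sqrrD a2 -addrA => /addrI.
by rewrite -/(m k) -[in RHS]mk; ring.
Qed.

(** Each diagonal entry is the quadratic form of [Y] at a row of [T]. That row reads off the
    constant 1 or a coordinate of the affine image, hence is 0/1-valued on vertices, and
    [quad_form_diagonal] makes the form linear. *)
Lemma diagonal_congruence M b (Y : 'M[R]_(1 + d)) :
  (forall x, vertices01 x -> vertices01 (affine M b x)) ->
  Y^T = Y -> Y *m homog 0 = diagonal Y ->
  diagonal (homogenization M b *m Y *m (homogenization M b)^T) =
  homogenization M b *m diagonal Y.
Proof.
move=> AV YT Y0; set T := homogenization M b.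
have rowT i x : (row i T *m homog x) 0 0 = homog (affine M b x) i 0.
  by rewrite -row_mul homogenization_homog mxE.
apply/colP => i; rewrite mxE.
have -> : (T *m Y *m T^T) i i = (row i T *m Y *m (row i T)^T) 0 0.
  by rewrite -row_mul !mxE; apply: eq_bigr => k _; rewrite !mxE.
rewrite quad_form_diagonal -?row_mul ?mxE // => x /AV Vx; rewrite rowT.
rewrite -[i]splitK; case: (split i) => j /=.
  by right; rewrite /homog col_mxEu mxE ord1.
by rewrite /homog col_mxEd; exact: Vx.
Qed.

(** Test vectors are pulled back by [T^T]: since [T] maps [Q] into [Q] and [K_P] into [K_P'], its
    transpose maps the dual cones the other way. *)
Lemma M_LS_congruence M b (P P' : set 'cV[R]_d) Y :
  (forall x, vertices01 x -> vertices01 (affine M b x)) ->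
  (forall x, P x -> P' (affine M b x)) ->
  M_LS (K_of P) Y ->
  M_LS (K_of P') (homogenization M b *m Y *m (homogenization M b)^T).
Proof.
move=> AV AP [/symmetricmxP YT]; rewrite -homog0 => Y0 Yuw; split.
- by apply/symmetricmxP; rewrite !trmx_mul trmxK YT mulmxA.
- rewrite -homog0 diagonal_congruence // -!mulmxA.
  by rewrite trmx_homogenization_homog0 Y0.
- move=> u w Qu Kw.
  have := Yuw _ _ (dual_cone_trmx (Qcone_homogenization AV) Qu)
                  (dual_cone_trmx (K_of_homogenization AP) Kw).
  by rewrite trmx_mul trmxK !mulmxA.
Qed.

End Congruence.

(** * Uniform treatment of [N] and [N_+] *)

Section Relaxation.
Variables (R : realType) (d : nat).
Implicit Types (C : set 'M[R]_(1 + d)) (P : set 'cV[R]_d).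

(* [C = setT] gives [N(P)] and [C = psd] gives [N_+(P)]. *)
Definition LS_within C P : set 'cV[R]_d :=
  [set x | exists2 Y, (M_LS (K_of P) `&` C) Y & diagonal Y = homog x].

(** The three closure conditions serve, respectively, affine images, convexity, and membership of
    the origin. *)
Definition admissible C : Prop :=
  [/\ forall T Y, C Y -> C (T *m Y *m T^T),
      forall t Y Z, 0 <= t <= 1 -> C Y -> C Z -> C (t *: Y + (1 - t) *: Z) &
      C (homog 0 *m (homog 0)^T)].

Lemma admissible_setT : admissible setT.
Proof. by []. Qed.

Lemma admissible_psd : admissible (@psd R (1 + d)).
Proof.
split=> [T Y [/symmetricmxP YT Y0]|t Y Z /andP[t0 t1] [/symmetricmxP YT Y0]
  [/symmetricmxP ZT Z0]|].
- split=> [|x]; first by apply/symmetricmxP; rewrite !trmx_mul trmxK YT mulmxA.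
  by have := Y0 (T^T *m x); rewrite trmx_mul trmxK !mulmxA.
- split=> [|x].
    by apply/symmetricmxP; rewrite linearD !linearZ /= YT ZT.
  rewrite mulmxDr mulmxDl -!scalemxAr -!scalemxAl.
  rewrite mxE [X in X + _]mxE [X in _ + X]mxE.
  by rewrite addr_ge0 // mulr_ge0 ?subr_ge0.
- split=> [|x]; first by apply/symmetricmxP; rewrite trmx_mul trmxK.
  have -> : x^T *m (homog 0 *m (homog 0)^T) *m x =
      ((homog 0)^T *m x)^T *m ((homog 0)^T *m x).
    by rewrite trmx_mul trmxK !mulmxA.
  by rewrite mxE big_ord1 mxE -expr2 sqr_ge0.
Qed.

Variable C : set 'M[R]_(1 + d).
Hypothesis admC : admissible C.

Lemma LS_within_affine M b P P' :
  (forall x, vertices01 x -> vertices01 (affine M b x)) ->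
  (forall x, P x -> P' (affine M b x)) ->
  forall x, LS_within C P x -> LS_within C P' (affine M b x).
Proof.
move=> AV AP x [Y [MY CY] Yx]; have [congC _ _] := admC.
exists (homogenization M b *m Y *m (homogenization M b)^T).
  by split; [exact: M_LS_congruence MY|exact: congC].
have [/symmetricmxP YT Y0 _] := MY; rewrite -homog0 in Y0.
by rewrite diagonal_congruence // Yx homogenization_homog.
Qed.

Lemma LS_within_conv P t x y : 0 <= t <= 1 ->
  LS_within C P x -> LS_within C P y ->
  LS_within C P (t *: x + (1 - t) *: y).
Proof.
move=> t01 [Y [[/symmetricmxP YT Y0 Yuw] CY] Yx].
move=> [Z [[/symmetricmxP ZT Z0 Zuw] CZ] Zy]; have [_ convC _] := admC.
have dE : diagonal (t *: Y + (1 - t) *: Z) =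
    t *: diagonal Y + (1 - t) *: diagonal Z by apply/colP => i; rewrite !mxE.
exists (t *: Y + (1 - t) *: Z); last by rewrite dE Yx Zy homog_conv.
split; last exact: convC.
split.
- by apply/symmetricmxP; rewrite linearD !linearZ /= YT ZT.
- by rewrite dE mulmxDl -!scalemxAl Y0 Z0.
- move=> u w Qu Kw; rewrite mulmxDr mulmxDl -!scalemxAr -!scalemxAl.
  rewrite mxE [X in X + _]mxE [X in _ + X]mxE.
  case/andP: t01 => t0 t1.
  by rewrite addr_ge0 // mulr_ge0 ?subr_ge0 ?Yuw ?Zuw.
Qed.

Lemma dual_cone_K_of P : dual_cone (K_of P) (homog 0).
Proof.
move=> z /K_ofP[l [x [_ l0 ->]]]; rewrite -scalemxAr mxE mulr_ge0 //.
by rewrite tr_col_mx mul_row_col trmx1 mul1mx trmx0 mul0mx addr0 mxE.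
Qed.

(** Since [e_0] lies in the dual of [K_P] and [Y e_0 = (1, x)], every form in the dual of [Q] is
    nonnegative at [(1, x)]. The forms [u0] and [u1] are [x_i] and [x_0 - x_i]. *)
Lemma LS_within_cube P : LS_within C P `<=` @cube01 R d.
Proof.
move=> x [Y [[YT Y0 Yuw] _] Yx] i; rewrite -homog0 in Y0.
have pos u : dual_cone (@Qcone R d) u -> 0 <= (u^T *m homog x) 0 0.
  by move=> Qu; have := Yuw _ _ Qu (@dual_cone_K_of P); rewrite -mulmxA Y0 Yx.
pose u0 : 'cV[R]_(1 + d) := col_mx 0 (delta_mx i 0).
pose u1 : 'cV[R]_(1 + d) := col_mx 1%:M (- delta_mx i 0).
have u0E y : (u0^T *m homog y) 0 0 = y i 0.
  rewrite tr_col_mx mul_row_col trmx0 mul0mx add0r trmx_delta -rowE.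
  by rewrite mxE.
have u1E y : (u1^T *m homog y) 0 0 = 1 - y i 0.
  rewrite tr_col_mx mul_row_col trmx1 mul1mx linearN /= trmx_delta mulNmx -rowE.
  by rewrite !mxE.
apply/andP; split.
  rewrite -u0E; apply/pos/dual_cone_generated => _ [y Vy <-].
  by rewrite u0E; case: (Vy i) => ->.
rewrite -subr_ge0 -u1E; apply/pos/dual_cone_generated => _ [y Vy <-].
by rewrite u1E subr_ge0; case: (Vy i) => ->.
Qed.

(** The origin is a vertex of the cube, so it lifts to the rank-one matrix [e_0 e_0^T]. *)
Lemma LS_within0 P : P 0 -> LS_within C P 0.
Proof.
move=> P0; have [_ _ C0] := admC.
have dE : diagonal (homog 0 *m (homog 0)^T) = homog 0 :> 'cV[R]_(1 + d).
  by apply/colP => i; rewrite homog0 trmx_delta mul_delta_mx !mxE eqxx andbT andbb.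
have e0E : (homog 0)^T *m homog (0 : 'cV[R]_d) = 1%:M.
  by rewrite /homog tr_col_mx mul_row_col trmx1 mul1mx trmx0 mul0mx addr0.
exists (homog 0 *m (homog 0)^T) => //; split=> //; split.
- by apply/symmetricmxP; rewrite trmx_mul trmxK.
- by rewrite -homog0 dE -mulmxA e0E mulmx1.
(* The value is [u_0 w_0]; both factors are nonnegative because [(1, 0)] lies in [Q] and in
   [K_P]. *)
- move=> u w Qu Kw; rewrite mulmxA -(mulmxA _ _ w) mxE big_ord1 mulr_ge0 //.
    apply: Qu; exists 1%N, (fun=> 1), (fun=> homog 0); split=> //.
      by move=> _; exists 0 => // i; left; rewrite mxE.
    by rewrite big_ord1 scale1r.
  have -> : (homog 0)^T *m w = (w^T *m homog 0)^T by rewrite trmx_mul trmxK.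
  by rewrite mxE; apply/Kw/K_ofP; exists 1, 0; split; rewrite ?scale1r.
Qed.

(* Truncating [z_i] to [c] is a convex combination of [z] and the image of [z]
   under the affine map [x_i |-> 0], which preserves both the vertices and
   every lower comprehensive set. *)
Lemma LS_within_lower_coord P z i c : lower_comprehensive P ->
  LS_within C P z -> 0 <= c <= z i 0 ->
  LS_within C P (z - (z i 0 - c) *: delta_mx i 0).
Proof.
move=> [_ _ P0 Plow] Fz /andP[c0 cz].
pose D : 'M[R]_d := 1%:M - delta_mx i i.
have DE x : affine D 0 x = x - x i 0 *: delta_mx i 0.
  rewrite /affine addr0 mulmxBl mul1mx; congr (_ - _).
  apply/colP => j; rewrite !mxE (bigD1 i) //= big1 => [|k ki].
    by rewrite mxE !eqxx !andbT addr0 mulrC.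
  by rewrite mxE (negPf ki) andbF mul0r.
have Dx x j : affine D 0 x j 0 = if j == i then 0 else x j 0.
  rewrite DE !mxE andbT; case: eqP => [->|_]; first by rewrite mulr1 subrr.
  by rewrite mulr0 subr0.
have FDz : LS_within C P (affine D 0 z).
  apply: LS_within_affine Fz => x.
    by move=> Vx j; rewrite Dx; case: ifP => _; [left|exact: Vx].
  move=> Px; have x0 := P0 _ Px.
  by apply: (Plow x) => // j; rewrite Dx; case: ifP.
pose t := c / z i 0.
have tz : t * z i 0 = c.
  have [zi0|zi0] := eqVneq (z i 0) 0; last by rewrite divfK.
  (* If [z_i = 0], the bounds force [c = 0], so the default value of [c / 0] does no harm. *)
  by apply/eqP; rewrite zi0 mulr0 eq_le c0 -zi0.
have t01 : 0 <= t <= 1.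
  have := le_trans c0 cz; rewrite le_eqVlt => /predU1P[zi0|zi0].
    by rewrite /t -zi0 invr0 mulr0 lexx ler01.
  by rewrite divr_ge0 ?(ltW zi0) //= ler_pdivrMr // mul1r.
have := LS_within_conv t01 Fz FDz; congr LS_within.
by apply/colP => j; rewrite DE !mxE -tz; ring.
Qed.

Lemma LS_within_lower_comprehensive P :
  lower_comprehensive P -> lower_comprehensive (LS_within C P).
Proof.
move=> lP; have [[p Pp] _ P0 Plow] := lP; split.
- exists 0; apply: LS_within0; apply: (Plow p) => // i; rewrite mxE //.
  exact: P0.
- by apply/convex_setP => t x y t01; exact: LS_within_conv.
- by move=> x /LS_within_cube x01 i; case/andP: (x01 i).
- move=> x y Fx y0 yx.
  (* Coordinates are lowered from [x] to [y] one at a time; [s] lists those already done. *)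
  pose z (s : seq 'I_d) : 'cV[R]_d := \col_j if j \in s then y j 0 else x j 0.
  suff Fz (s : seq _) : LS_within C P (z s).
    by have := Fz (enum 'I_d); congr LS_within; apply/colP => j;
      rewrite mxE mem_enum.
  elim: s => [|i s Fz].
    by move: Fx; congr LS_within; apply/colP => j; rewrite mxE.
  have yz : 0 <= y i 0 <= z s i 0.
    by rewrite y0 mxE /=; case: ifP => _; rewrite ?lexx ?yx.
  have := LS_within_lower_coord lP Fz yz; congr LS_within.
  apply/colP => j; rewrite !mxE inE andbT; case: eqVneq => [->|_] /=.
    by rewrite mulr1 opprB addrC subrK.
  by rewrite mulr0 subr0.
Qed.

Lemma convex_corner_LS_within v P :
  convex_corner v P -> convex_corner v (LS_within C P).
Proof.
move=> [_ _ [M [b [[uM AV AQ] Av lAP]]]].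
split; [|exact: LS_within_cube|].
  by apply/convex_setP => t x y t01; exact: LS_within_conv.
exists M, b; split=> //.
have AV1 x : vertices01 x -> vertices01 (affine M b x).
  by move=> Vx; rewrite -AV; exists x.
(* The inverse affine map. It preserves vertices because [A] is injective and maps the vertices onto
   themselves. *)
pose M' := invmx M; pose b' := - (M' *m b).
have AK : cancel (affine M b) (affine M' b').
  by move=> x; rewrite /affine mulmxDr mulKmx // addrK.
have AK' : cancel (affine M' b') (affine M b).
  by move=> x; rewrite /affine mulmxDr mulmxN !mulKVmx // subrK.
have AV2 x : vertices01 x -> vertices01 (affine M' b' x).
  by rewrite -{1}AV => -[y Vy <-]; rewrite AK.
suff -> : affine M b @` LS_within C P = LS_within C (affine M b @` P).
  exact: LS_within_lower_comprehensive.
apply/seteqP; split=> [_ [x Fx <-]|x Fx].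
  by apply: LS_within_affine Fx => // y Py; exists y.
exists (affine M' b' x); last exact: AK'.
by apply: LS_within_affine Fx => // _ [y Py <-]; rewrite AK.
Qed.

End Relaxation.

Theorem theorem5p2 (R : realType) (d : nat) (v : 'cV[R]_d) (P : set 'cV[R]_d)
    (hv : vertices01 v) (hP : convex_corner v P) :
  convex_corner v (N_LS P) /\ convex_corner v (Nplus_LS P).
Proof.
split; last exact: convex_corner_LS_within (@admissible_psd R d) _ _ hP.
have -> : N_LS P = LS_within setT P by rewrite /LS_within setIT.
exact: convex_corner_LS_within (@admissible_setT R d) _ _ hP.
Qed.
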